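(* Let $\mathbf{G}$ be a (small) groupoid with set of morphisms $G_1$. Put $X=G_1$ and let $m\colon X\times X\to X$ be the relation that is the graph of the composition of $\mathbf{G}$, i.e. $m=\{((g,f),gf)\mid g,f\in G_1,\ s(g)=t(f)\}$, where $s,t$ are source and target. Then $(X,m)$ is a relative Frobenius algebra.
   Context: $\mathbf{Rel}$ is the category of sets and relations: morphisms $r\colon X\to Y$ are subsets $r\subseteq X\times Y$, with composition $s\circ r=\{(x,z)\mid\exists y:(x,y)\in r,(y,z)\in s\}$. $r^\dagger$ is the converse relation, $\times$ (on objects and morphisms) is the monoidal structure given by Cartesian product of sets, the symbol $1$ denotes both identity relations and the one-point set, and associativity and unit isomorphisms are suppressed. A relative Frobenius algebra is a set $X$ with a relation $m\colon X\times X\to X$ in $\mathbf{Rel}$ such that: (F) $(1\times m)\circ(m^\dagger\times 1)=m^\dagger\circ m=(m\times 1)\circ(1\times m^\dagger)$; (M) $m\circ m^\dagger=1$; (A) $m\circ(1\times m)=m\circ(m\times 1)$; (U) there is a relation $u\colon 1\to X$ with $m\circ(u\times 1)=1=m\circ(1\times u)$. *)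

(* Defs.v *)
From mathcomp Require Import all_boot.
From mathcomp Require Import boolp classical_sets.

Set Implicit Arguments.
Unset Strict Implicit.
Unset Printing Implicit Defensive.

Local Open Scope classical_set_scope.
Local Open Scope relation_scope.

(* A morphism X -> Y of Rel is an element of [set (X * Y)].  The composite
   "s after r" is [s \; r], the converse is [r^-1], and the identity is
   [diagonal] (all three from classical_sets).  The monoidal unit is [unit]. *)

Definition rel_prod (X X' Y Y' : Type) (r : set (X * Y)) (r' : set (X' * Y')) :
    set ((X * X') * (Y * Y')) :=
  [set p | r (p.1.1, p.2.1) /\ r' (p.1.2, p.2.2)].

Definition rel_graph (X Y : Type) (f : X -> Y) : set (X * Y) :=
  [set p | f p.1 = p.2].

Definition rel_assoc (X Y Z : Type) : set (((X * Y) * Z) * (X * (Y * Z))) :=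
  rel_graph (fun p => (p.1.1, (p.1.2, p.2))).

Definition rel_lunit (X : Type) : set ((unit * X) * X) := rel_graph snd.

Definition rel_runit (X : Type) : set ((X * unit) * X) := rel_graph fst.

Arguments rel_assoc : clear implicits.
Arguments rel_lunit : clear implicits.
Arguments rel_runit : clear implicits.

(* The coherence isomorphisms of Rel, usually suppressed, are inserted where
   typing requires them. *)
Record relative_Frobenius_algebra (X : Type) (m : set ((X * X) * X)) : Prop := {
  relFrob_F :
    rel_prod diagonal m \; (rel_assoc X X X \; rel_prod (m^-1) diagonal)
      = m^-1 \; m
    /\ m^-1 \; m =
    rel_prod m diagonal \; ((rel_assoc X X X)^-1 \; rel_prod diagonal (m^-1));
  relFrob_M : m \; m^-1 = diagonal;
  relFrob_A :
    m \; (rel_prod diagonal m \; rel_assoc X X X) = m \; rel_prod m diagonal;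
  relFrob_U : exists u : set (unit * X),
    m \; rel_prod u diagonal = rel_lunit X
    /\ m \; rel_prod diagonal u = rel_runit X
}.

(* Composition is in applicative order, [mor_comp e] being "g after f" for
   [e : src g = tgt f].  The laws are stated for arbitrary composability
   proofs; these carry no information by proof irrelevance. *)
Record small_category : Type := {
  obj : Type;
  mor : Type;
  src : mor -> obj;
  tgt : mor -> obj;
  mor_id : obj -> mor;
  mor_comp : forall g f : mor, src g = tgt f -> mor;
  src_id : forall x, src (mor_id x) = x;
  tgt_id : forall x, tgt (mor_id x) = x;
  src_comp : forall g f (e : src g = tgt f), src (mor_comp e) = src f;
  tgt_comp : forall g f (e : src g = tgt f), tgt (mor_comp e) = tgt g;
  comp_idl : forall f (e : src (mor_id (tgt f)) = tgt f), mor_comp e = f;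
  comp_idr : forall f (e : src f = tgt (mor_id (src f))), mor_comp e = f;
  comp_assoc : forall h g f (ehg : src h = tgt g) (egf : src g = tgt f)
      (el : src h = tgt (mor_comp egf)) (er : src (mor_comp ehg) = tgt f),
    mor_comp el = mor_comp er
}.

Definition is_iso (C : small_category) (g : mor C) : Prop :=
  exists (h : mor C) (e : src g = tgt h) (e' : src h = tgt g),
    mor_comp e = mor_id (tgt g) /\ mor_comp e' = mor_id (src g).

Record groupoid : Type := {
  groupoid_cat :> small_category;
  groupoid_iso : forall g : mor groupoid_cat, is_iso g
}.

Definition comp_rel (G : small_category) : set ((mor G * mor G) * mor G) :=
  [set p | exists e : src p.1.1 = tgt p.1.2, mor_comp e = p.2].

Arguments comp_rel : clear implicits.

(* Main.v *)
Require Import Defs.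
From mathcomp Require Import all_boot.
From mathcomp Require Import boolp classical_sets.

Set Implicit Arguments.
Unset Strict Implicit.

(** In a category, composition is a partial function, so [comp_rel] is
    single-valued; identities make it surjective, which gives (M), and make the
    set of all identities the unit in (U).  Associativity, in the relational
    form [comp_rel_assocr] and [comp_rel_assocl], gives (A): one bracketing is
    defined as soon as the other is, since composability only concerns
    endpoints.

    Inverses enter through (F) alone.  All three relations in (F) turn out to
    be the one relating [(a, b)] to [(c, d)] when [ab = cd].  The left one says
    that some [q] satisfies [cq = a] and [qb = d], whence [ab = cqb = cd];
    conversely, if [ab = cd] then [a] and [c] have the same target, so
    [q = c^-1 a] exists, and cancelling [c] from [c(qb) = ab = cd] gives
    [qb = d].  The right one is the mirror image, with [ap = c] and [pd = b].
    The existence of quotients and cancellation are [comp_rel_divl],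
    [comp_rel_cancell] and their mirror images; each is itself an instance of
    relational associativity with an inverse as one of the factors. *)

Section Category.

Variable C : small_category.
Implicit Types f g h x y z : mor C.

Lemma comp_rel_ends g f h :
  comp_rel C ((g, f), h) -> [/\ src g = tgt f, src h = src f & tgt h = tgt g].
Proof. by case=> /= e <-; split; rewrite ?src_comp ?tgt_comp. Qed.

Lemma comp_rel_total g f : src g = tgt f -> exists h, comp_rel C ((g, f), h).
Proof. by move=> e; exists (mor_comp e); exists e. Qed.

(** Two proofs of composability are equal by proof irrelevance, so the composite
    does not depend on the one that witnesses membership. *)
Lemma comp_rel_fun g f h h' :
  comp_rel C ((g, f), h) -> comp_rel C ((g, f), h') -> h = h'.
Proof. by move=> [/= e <-] [/= e' <-]; rewrite (Prop_irrelevance e e'). Qed.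

Lemma comp_rel_idl f : comp_rel C ((mor_id (tgt f), f), f).
Proof. by exists (src_id (tgt f)); exact: comp_idl. Qed.

Lemma comp_rel_idr f : comp_rel C ((f, mor_id (src f)), f).
Proof. by exists (esym (tgt_id (src f))); exact: comp_idr. Qed.

Lemma comp_rel_idl_eq o f h : comp_rel C ((mor_id o, f), h) -> f = h.
Proof.
move=> c; have [/= e _ _] := comp_rel_ends c.
move: c; rewrite src_id in e; rewrite e; exact/comp_rel_fun/comp_rel_idl.
Qed.

Lemma comp_rel_idr_eq o f h : comp_rel C ((f, mor_id o), h) -> f = h.
Proof.
move=> c; have [/= e _ _] := comp_rel_ends c.
move: c; rewrite tgt_id in e; rewrite -e; exact/comp_rel_fun/comp_rel_idr.
Qed.

Lemma comp_rel_assocr h g f x y :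
  comp_rel C ((h, g), x) -> comp_rel C ((x, f), y) ->
  exists2 z, comp_rel C ((g, f), z) & comp_rel C ((h, z), y).
Proof.
move=> [/= ehg <-] [/= er <-].
have egf : src g = tgt f by rewrite -er src_comp.
have el : src h = tgt (mor_comp egf) by rewrite tgt_comp.
exists (mor_comp egf); first by exists egf.
by exists el; exact: comp_assoc.
Qed.

Lemma comp_rel_assocl h g f z y :
  comp_rel C ((g, f), z) -> comp_rel C ((h, z), y) ->
  exists2 x, comp_rel C ((h, g), x) & comp_rel C ((x, f), y).
Proof.
move=> [/= egf <-] [/= el <-].
have ehg : src h = tgt g by rewrite el tgt_comp.
have er : src (mor_comp ehg) = tgt f by rewrite src_comp.
exists (mor_comp ehg); first by exists ehg.
by exists er; rewrite (comp_assoc el er).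
Qed.

(** Overlapping factorizations glue: composability of [hg] and of [gf] already
    makes the threefold composite defined.  This gives the easy inclusions of
    the Frobenius law, valid in any category. *)
Lemma comp_rel_glue h g f x z :
  comp_rel C ((h, g), x) -> comp_rel C ((g, f), z) ->
  exists2 y, comp_rel C ((x, f), y) & comp_rel C ((h, z), y).
Proof.
move=> chg cgf.
have [egf _ _] := comp_rel_ends cgf.
have [_ sx _] := comp_rel_ends chg.
have [y cy] : exists y, comp_rel C ((x, f), y)
  by apply: comp_rel_total; rewrite sx.
have [z' cz' chz'] := comp_rel_assocr chg cy.
by exists y; rewrite // (comp_rel_fun cgf cz').
Qed.

End Category.

Section Groupoid.

Variable G : groupoid.
Implicit Types a b c d f g h y z : mor G.

Lemma comp_rel_inv g : exists2 h,
  comp_rel G ((g, h), mor_id (tgt g)) & comp_rel G ((h, g), mor_id (src g)).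
Proof.
by have [h [e [e' [gh hg]]]] := groupoid_iso g; exists h; [exists e | exists e'].
Qed.

(** Rebracketing [(c c^-1) a = a] produces the quotient [c^-1 a]. *)
Lemma comp_rel_divl c a : tgt a = tgt c -> exists q, comp_rel G ((c, q), a).
Proof.
move=> eac; have [h ch _] := comp_rel_inv c; rewrite -eac in ch.
by have [q _ cq] := comp_rel_assocr ch (comp_rel_idl a); exists q.
Qed.

Lemma comp_rel_divr d b : src b = src d -> exists p, comp_rel G ((p, d), b).
Proof.
move=> ebd; have [h _ hd] := comp_rel_inv d; rewrite -ebd in hd.
by have [p _ cp] := comp_rel_assocl hd (comp_rel_idr b); exists p.
Qed.

(** A factor is determined by the product, because rebracketing
    [(c^-1 c) z = z] exhibits [z] as [c^-1 y]. *)
Lemma comp_rel_cancell c y z z' :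
  comp_rel G ((c, z), y) -> comp_rel G ((c, z'), y) -> z = z'.
Proof.
have [h _ hc] := comp_rel_inv c.
have hy w : comp_rel G ((c, w), y) -> comp_rel G ((h, y), w).
  move=> cw; have [e _ _] := comp_rel_ends cw.
  move: hc; rewrite e => hc.
  have [y' cy' hy'] := comp_rel_assocr hc (comp_rel_idl w).
  by rewrite (comp_rel_fun cw cy').
by move=> /hy hz /hy; exact: comp_rel_fun.
Qed.

Lemma comp_rel_cancelr d y z z' :
  comp_rel G ((z, d), y) -> comp_rel G ((z', d), y) -> z = z'.
Proof.
have [h dh _] := comp_rel_inv d.
have yh w : comp_rel G ((w, d), y) -> comp_rel G ((y, h), w).
  move=> cw; have [e _ _] := comp_rel_ends cw.
  move: dh; rewrite -e => dh.
  have [y' cy' yh'] := comp_rel_assocl dh (comp_rel_idr w).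
  by rewrite (comp_rel_fun cw cy').
by move=> /yh hz /yh; exact: comp_rel_fun.
Qed.

(** Two factorizations of one morphism have a diagonal filler [q = c^-1 a]: this
    is the inclusion of the Frobenius law that fails in a general category. *)
Lemma comp_rel_fillerl a b c d y :
  comp_rel G ((a, b), y) -> comp_rel G ((c, d), y) ->
  exists2 q, comp_rel G ((c, q), a) & comp_rel G ((q, b), d).
Proof.
move=> ab cd.
have [_ _ ta] := comp_rel_ends ab.
have [_ _ tc] := comp_rel_ends cd.
have [q cq] : exists q, comp_rel G ((c, q), a)
  by apply: comp_rel_divl; rewrite -ta.
have [d' qb cd'] := comp_rel_assocr cq ab.
by exists q; rewrite // (comp_rel_cancell cd cd').
Qed.

Lemma comp_rel_fillerr a b c d y :
  comp_rel G ((a, b), y) -> comp_rel G ((c, d), y) ->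
  exists2 p, comp_rel G ((p, d), b) & comp_rel G ((a, p), c).
Proof.
move=> ab cd.
have [_ sb _] := comp_rel_ends ab.
have [_ sd _] := comp_rel_ends cd.
have [p pd] : exists p, comp_rel G ((p, d), b)
  by apply: comp_rel_divr; rewrite -sb.
have [c' ap c'd] := comp_rel_assocl pd ab.
by exists p; rewrite // (comp_rel_cancelr cd c'd).
Qed.

End Groupoid.

Theorem theorem12 (G : groupoid) : relative_Frobenius_algebra (comp_rel G).
Proof.
split.
- split; apply/seteqP; split=> -[[a b] [c d]].
  + case=> -[p [q b']] [[[p' q'] b'']] [/= cq /diagonalP/= ?] [? ? ?].
    case=> /= /diagonalP/= ? qb; subst.
    by have [y ab cd] := comp_rel_glue cq qb; exists y.
  + case=> y /= ab cd.
    have [q cq qb] := comp_rel_fillerl ab cd.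
    by exists (c, (q, b)) => //; exists ((c, q), b).
  + case=> y /= ab cd.
    have [p pd ap] := comp_rel_fillerr ab cd.
    by exists ((a, p), d) => //; exists (a, (p, d)).
  + case=> -[[a' p] d'] [[a'' [p' d'']]] [/= /diagonalP/= ? pd] [? ? ?].
    case=> /= ap /diagonalP/= ?; subst.
    by have [y cd ab] := comp_rel_glue ap pd; exists y.
- apply/seteqP; split=> -[z z'].
  + by case=> -[g f]; exact: comp_rel_fun.
  + move=> /diagonalP <-.
    by exists (mor_id (tgt z), z); exact: comp_rel_idl.
- apply/seteqP; split=> -[[[h g] f] y].
  + case=> -[h' z] [[h'' [g' f']]] [<- <- <-].
    case=> /= /diagonalP/= <- gf hz.
    have [x hg xf] := comp_rel_assocl gf hz.
    by exists (x, f).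
  + case=> -[x f'] [/= hg /diagonalP/= <-] xf.
    have [z gf hz] := comp_rel_assocr hg xf.
    by exists (h, z) => //; exists (h, (g, f)).
- exists [set p | exists o, p.2 = mor_id o]%classic.
  split; apply/seteqP; split=> -[].
  + move=> [t f] h [[g f']] [/= [o ->] /diagonalP/= <-]; exact: comp_rel_idl_eq.
  + move=> [t f] h; rewrite /rel_lunit /rel_graph /= => <-.
    exists (mor_id (tgt f), f); last exact: comp_rel_idl.
    by split=> //; exists (tgt f).
  + move=> [f t] h [[f' g]] [/= /diagonalP/= <- [o ->]]; exact: comp_rel_idr_eq.
  + move=> [f t] h; rewrite /rel_runit /rel_graph /= => <-.
    exists (f, mor_id (src f)); last exact: comp_rel_idr.
    by split=> //; exists (src f).
Qed.
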